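(* Fix integers $h\ge 1$ and $k\ge h+1$, and put $a=k-h-1$. There exists an integer $n_{\mathrm{int}}(k,k+h)\ge 2(k+h)+2$ such that for every $n\ge n_{\mathrm{int}}(k,k+h)$ the following holds. The partition $U,\ I,\ W,\ Z,\ Y_0$ of $V(G^{\min}_{h,k,n})$, after deleting the empty class $W$ when $a=0$, is equitable. Its class sizes are $(2h,\,2,\,a,\,2h,\,q_{\min})$ with $q_{\min}=n-k-3h-1$, and its quotient matrix is $Q^{\min}_{h,k,n}$. Consequently, $$\min_{G\in\mathcal{L}_{\mathcal{H}}^{2}(n,k,k+h)}\rho(G)=\rho\bigl(G^{\min}_{h,k,n}\bigr)=\rho\bigl(Q^{\min}_{h,k,n}\bigr).$$
   Context: All graphs are finite, simple and undirected; $\rho$ denotes the (adjacency) spectral radius. A partition $V_1,\dots,V_m$ of $V(G)$ into nonempty classes is equitable if every vertex of $V_i$ has the same number $q_{ij}$ of neighbors in $V_j$ for all $i,j$; its quotient matrix is $(q_{ij})$. Family $\mathcal{L}_{\mathcal{H}}^{2}(n,k,\delta)$ (with $h=\delta-k$): all graphs $G$ (up to isomorphism) obtained as follows. Take pairwise disjoint vertex sets $X,W,Y$ with $|X|=2h+2$, $|W|=k-h-1$, $|Y|=n-k-h-1$. Choose a connected graph $H$ with vertex set $X$ and exactly $\binom{2h+2}{2}-h$ edges. Start from $K_W\vee(H\cup K_Y)$, where $K_W,K_Y$ are complete graphs on $W,Y$ ($K_\varnothing$ is the empty graph), $\cup$ is disjoint union and $\vee$ is the graph join. Then add a set of exactly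 $2h$ edges, each joining a vertex of $X$ to a vertex of $Y$, so that every vertex of $X$ has degree at least $\delta$ in the resulting graph. Graph $G^{\min}_{h,k,n}$ ($h\ge1$): the vertex set is $X\,\dot\cup\,W\,\dot\cup\,Y$ with $|X|=2h+2$, $|W|=k-h-1$, $|Y|=n-k-h-1$, $X=U\,\dot\cup\,I$, $U=\{u_1,v_1,\dots,u_h,v_h\}$, $|I|=2$. The graph induced on $X$ is the complete graph $K_X$ with the edges $u_iv_i$ ($1\le i\le h$) deleted; $W\cup Y$ induces a clique; every vertex of $W$ is adjacent to every vertex of $X$; for pairwise distinct $y_1,\dots,y_{2h}\in Y$, the only neighbor of $u_i$ in $Y$ is $y_{2i-1}$ and the only neighbor of $v_i$ in $Y$ is $y_{2i}$; the vertices of $I$ have no neighbors in $Y$. Put $Z=\{y_1,\dots,y_{2h}\}$ and $Y_0=Y\setminus Z$. With rows and columns ordered as $U,I,W,Z,Y_0$, $$Q^{\min}_{h,k,n}=\begin{pmatrix}2h-2&2&a&1&0\\2h&1&a&0&0\\2h&2&a-1&2h&q_{\min}\\1&0&a&2h-1&q_{\min}\\0&0&a&2h&q_{\min}-1\end{pmatrix},$$ where, when $a=0$, the third row and third column are deleted. *)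

(* Defs.v *)
From mathcomp Require Import all_boot all_order all_algebra.
From mathcomp Require Import reals complex.

Set Implicit Arguments.
Unset Strict Implicit.
Unset Printing Implicit Defensive.

Import Order.TTheory GRing.Theory Num.Theory.
Local Open Scope ring_scope.

Section SpectralRadius.
Variable R : realType.

(* The matrix is complexified, since a real matrix that is not symmetric need
   not have all its eigenvalues in R. *)
Definition complex_mx (n : nat) (A : 'M[R]_n) : 'M[R[i]]_n :=
  map_mx (real_complex R) A.

Definition spectrum (n : nat) (A : 'M[R]_n) : seq R[i] :=
  sval (closed_field_poly_normal (char_poly (complex_mx A))).

Definition spectral_radius (n : nat) (A : 'M[R]_n) : R :=
  \big[Num.max/0]_(z <- spectrum A) Normc.normc z.

Lemma mem_spectrum (n : nat) (A : 'M[R]_n) (z : R[i]) :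
  (z \in spectrum A) = eigenvalue (complex_mx A) z.
Proof.
rewrite eigenvalue_root_char /spectrum.
case: closed_field_poly_normal => r /= Dp.
by rewrite [in RHS]Dp (monicP (char_poly_monic _)) scale1r root_prod_XsubC.
Qed.

End SpectralRadius.

Record sgraph := SGraph {
  vertex :> finType;
  adj : rel vertex;
  adj_sym : symmetric adj;
  adj_irr : irreflexive adj
}.

Definition isomorphic (G G' : sgraph) : Prop :=
  exists f : G -> G', bijective f /\ (forall x y, adj (f x) (f y) = adj x y).

Definition neighbors (G : sgraph) (x : G) : {set G} := [set y | adj x y].

Definition degree (G : sgraph) (x : G) : nat := #|neighbors x|.

Definition edges (G : sgraph) : {set {set G}} :=
  [set [set p.1; p.2] | p : G * G & adj p.1 p.2].

Definition connected (G : sgraph) : Prop :=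
  (0 < #|G|)%N /\ forall x y : G, connect (@adj G) x y.

Definition adjacency_mx (R : realType) (G : sgraph) : 'M[R]_#|G| :=
  \matrix_(i, j) (adj (enum_val i) (enum_val j))%:R.

Definition graph_radius (R : realType) (G : sgraph) : R :=
  spectral_radius (adjacency_mx R G).

Definition is_min_radius (R : realType) (P : sgraph -> Prop) (r : R) : Prop :=
  (exists2 G, P G & graph_radius R G = r) /\
  (forall G, P G -> r <= graph_radius R G).

Section Partitions.
Variables (G : sgraph) (m : nat) (V : 'I_m -> {set G}).

Definition is_partition : Prop :=
  [/\ forall i, V i != set0,
      forall i j, i != j -> [disjoint V i & V j]
    & \bigcup_i V i = [set: G]].

Definition counts (q : 'I_m -> 'I_m -> nat) : Prop :=
  forall i j x, x \in V i -> #|neighbors x :&: V j| = q i j.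

Definition equitable : Prop := is_partition /\ exists q, counts q.

Definition is_quotient_mx (R : realType) (Q : 'M[R]_m) : Prop :=
  exists2 q, counts q & Q = \matrix_(i, j) (q i j)%:R.

End Partitions.

Section GraphOperations.

Definition complete_adj (n : nat) : rel 'I_n := fun x y => x != y.

Lemma complete_sym n : symmetric (@complete_adj n).
Proof. by move=> x y; rewrite /complete_adj eq_sym. Qed.

Lemma complete_irr n : irreflexive (@complete_adj n).
Proof. by move=> x; rewrite /complete_adj eqxx. Qed.

Definition complete (n : nat) : sgraph :=
  SGraph (@complete_sym n) (@complete_irr n).

Variables G1 G2 : sgraph.

Definition gsum_adj (b : bool) : rel (G1 + G2)%type := fun x y =>
  match x, y with
  | inl x1, inl y1 => adj x1 y1
  | inr x2, inr y2 => adj x2 y2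
  | _, _ => b
  end.

Lemma gsum_sym b : symmetric (gsum_adj b).
Proof. by move=> [x|x] [y|y] //=; rewrite adj_sym. Qed.

Lemma gsum_irr b : irreflexive (gsum_adj b).
Proof. by move=> [x|x] /=; rewrite adj_irr. Qed.

Definition disjoint_union : sgraph := SGraph (gsum_sym false) (gsum_irr false).

Definition join : sgraph := SGraph (gsum_sym true) (gsum_irr true).

End GraphOperations.

Section CrossEdges.

(* K_a \/ (H \cup K_b), with vertex set W + (X + Y), together with the edges xy,
   (x, y) \in F, between X = V(H) and Y. *)
Variables (a b : nat) (H : sgraph) (F : {set H * 'I_b}).

Definition base_graph : sgraph :=
  join (complete a) (disjoint_union H (complete b)).

Definition cross_adj : rel base_graph := fun x y =>
  adj x y ||
  match x, y with
  | inr (inl u), inr (inr v) => (u, v) \in F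
  | inr (inr v), inr (inl u) => (u, v) \in F
  | _, _ => false
  end.

Lemma cross_sym : symmetric cross_adj.
Proof.
by move=> x y; rewrite /cross_adj adj_sym; case: x y => [x|[x|x]] [y|[y|y]].
Qed.

Lemma cross_irr : irreflexive cross_adj.
Proof. by move=> x; rewrite /cross_adj adj_irr; case: x => [x|[x|x]]. Qed.

Definition cross_graph : sgraph := SGraph cross_sym cross_irr.

Definition inX (x : H) : cross_graph := inr (inl x).

End CrossEdges.

Definition family_L2H (n k delta : nat) (G : sgraph) : Prop :=
  let h := (delta - k)%N in
  exists (H : sgraph) (F : {set H * 'I_(n - k - h - 1)}),
    let G0 := cross_graph (k - h - 1) F in
    [/\ #|H| = (2 * h + 2)%N,
        connected H,
        #|edges H| = ('C(2 * h + 2, 2) - h)%N,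
        #|F| = (2 * h)%N /\
        (forall x : H, (delta <= degree (inX (k - h - 1) F x))%N)
      & isomorphic G G0].

Section MinimalGraph.
Variables h k n : nat.

(* X = U + I, where U = 'I_h * bool: u_(i+1) is (i, false) and v_(i+1) is
   (i, true), while y_(j+1) is the element j of 'I_(n - k - h - 1). *)
Definition minX_adj : rel ('I_h * bool + 'I_2)%type := fun x y =>
  (x != y) &&
  match x, y with
  | inl (i, _), inl (j, _) => i != j
  | _, _ => true
  end.

Lemma minX_sym : symmetric minX_adj.
Proof.
by move=> x y; rewrite /minX_adj eq_sym; case: x y => [[i b]|x] [[j c]|y];
  rewrite // (eq_sym i).
Qed.

Lemma minX_irr : irreflexive minX_adj.
Proof. by move=> x; rewrite /minX_adj eqxx. Qed.

Definition minX : sgraph := SGraph minX_sym minX_irr.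

Definition minF : {set minX * 'I_(n - k - h - 1)} :=
  [set p : minX * 'I_(n - k - h - 1) |
    match p.1 : ('I_h * bool + 'I_2)%type with
    | inl (i, b) => val p.2 == (2 * i + b)%N
    | inr _ => false
    end].

Definition Gmin : sgraph := cross_graph (k - h - 1) minF.

Definition classU : {set Gmin} :=
  [set (inr (inl (inl u)) : Gmin) | u : 'I_h * bool].
Definition classI : {set Gmin} := [set (inr (inl (inr c)) : Gmin) | c : 'I_2].
Definition classW : {set Gmin} := [set (inl w : Gmin) | w : 'I_(k - h - 1)].
Definition classY : {set Gmin} :=
  [set (inr (inr y) : Gmin) | y : 'I_(n - k - h - 1)].
Definition classZ : {set Gmin} :=
  [set (inr (inr y) : Gmin) | y : 'I_(n - k - h - 1) & (y < 2 * h)%N].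
Definition classY0 : {set Gmin} := classY :\: classZ.

Definition qmin : nat := (n - k - 3 * h - 1)%N.

Definition classes5 (i : 'I_5) : {set Gmin} :=
  nth set0 [:: classU; classI; classW; classZ; classY0] i.

Definition sizes5 (i : 'I_5) : nat :=
  nth 0%N [:: 2 * h; 2; k - h - 1; 2 * h; qmin]%N i.

Definition Qmin5 (R : realType) : 'M[R]_5 :=
  let t : R := (2 * h)%N%:R in
  let a : R := (k - h - 1)%N%:R in
  let q : R := qmin%:R in
  \matrix_(i, j)
    nth 0 (nth [::]
      [:: [:: t - 2; 2; a;     1;     0    ];
          [:: t;     1; a;     0;     0    ];
          [:: t;     2; a - 1; t;     q    ];
          [:: 1;     0; a;     t - 1; q    ];
          [:: 0;     0; a;     t;     q - 1]] i) j.

End MinimalGraph.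

(* When a = 0 the class W, at position 2 among U, I, W, Z, Y0, is deleted:
   [kept 0] skips that position. *)
Definition nclasses (a : nat) : nat := if a is 0%N then 4 else 5.

Definition kept (a : nat) : 'I_(nclasses a) -> 'I_5 :=
  match a return 'I_(nclasses a) -> 'I_5 with
  | 0%N => lift (Ordinal (isT : (2 < 5)%N))
  | _.+1 => id
  end.

Definition min_classes (h k n : nat) (i : 'I_(nclasses (k - h - 1))) :
  {set Gmin h k n} := classes5 h k n (kept i).

Definition min_sizes (h k n : nat) (i : 'I_(nclasses (k - h - 1))) : nat :=
  sizes5 h k n (kept i).

Definition Qmin (h k n : nat) (R : realType) : 'M[R]_(nclasses (k - h - 1)) :=
  mxsub (@kept (k - h - 1)) (@kept (k - h - 1)) (Qmin5 h k n R).

(* Main.v *)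
Require Import Defs.
From mathcomp Require Import all_boot all_order all_algebra.
From mathcomp Require Import reals complex.
From mathcomp Require Import ring lra zify.


(** Put a = k - h - 1, b = n - k - h - 1 and m = a + b = |W u Y|.  A graph of
    the family is given by the graph H induced on X and by the set F of edges
    between X and Y; let f x be the number of edges of F at x in X.  The
    number of edges of H and of F are such that the lower bound k + h on the
    degrees in X can only hold with equality: f x is exactly the number of
    edges missing at x in H ([family_cross_degree]), and the f x sum up to 2h.

    W u Y is a clique on m vertices, so that the radius of G is close to m - 1.
    What X adds is, to first order, the contribution of the walks that leave
    the clique for one vertex x of X and come back at once; x has a + f x
    neighbours in the clique, hence the radius is m - 1 + S / m ^ 2 up to
    O(1 / m ^ 3), where S is the sum of the (a + f x) ^ 2.  The sum of the f x
    being fixed, S takes its least value S0 = 2h (a + 1) ^ 2 + 2 a ^ 2 exactly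
    when all the f x are at most 1.  There are two cases.

    If some f x is at least 2, then S >= S0 + 1, and this unit beats the error
    terms for large m: m - 1 + (S0 + 1) / m ^ 2 is at most the radius of G, by
    the Rayleigh quotient of a vector that is 1 on the clique
    ([cross_radius_ge]), and at least the radius of the matrix Qmin, by a
    positive vector v such that Qmin v <= r v ([trial_vector_bounds],
    [Qmin_radius_le]).

    If all the f x are at most 1, the edges missing in H form a perfect
    matching of 2h vertices of X, and G may differ from the minimal graph only
    in that some edges of F share their end in Y.  Let Z be any set of 2h
    vertices of Y that contains these ends.  The five classes need not be
    equitable in G, but the average number of neighbours that a vertex of one
    class has in another is the entry of Qmin ([sum_class_counts]), and a real
    eigenvalue of an averaged quotient matrix never exceeds the radius of the
    graph: evaluate the Rayleigh quotient at the eigenvector, spread over the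
    classes ([averaged_quotient_le]).  No asymptotics is involved here.

    Both cases use that the minimal graph has the same radius as Qmin, and that
    this radius is an eigenvalue of Qmin.  Eigenvectors of a quotient matrix
    lift to the graph ([quotient_radius_le]); conversely, a nonnegative Perron
    eigenvector of the graph, summed over the classes, is a left eigenvector of
    the quotient ([quotient_perron]).  The Perron eigenvector comes from the
    equality case of the Rayleigh inequality ([rayleigh]), itself a consequence
    of the unitary diagonalization of symmetric matrices. *)

Set Implicit Arguments.
Unset Strict Implicit.
Unset Printing Implicit Defensive.

Import Order.TTheory GRing.Theory Num.Theory.

(** * Degrees in a graph of the family *)

(** Each edge is the image of exactly two ordered adjacent pairs. *)
Lemma sum_degree (G : sgraph) : (\sum_(x : G) degree x = 2 * #|edges G|)%N.
Proof.
transitivity #|[set p : G * G | adj p.1 p.2]|.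
  rewrite -sum1_card.
  rewrite (eq_bigl (fun p => xpredT p.1 && adj p.1 p.2)) => [|p]; last first.
    by rewrite inE.
  rewrite -(pair_big_dep xpredT (fun x y => adj x y) (fun _ _ => 1%N)) /=.
  apply: eq_bigr => x _; rewrite /degree -sum1_card.
  by apply: eq_bigl => y; rewrite inE.
rewrite -sum1_card (partition_big_imset (fun p : G * G => [set p.1; p.2])) /=.
rewrite (_ : [set _ | p in _] = edges G); last first.
  by apply: eq_imset.
rewrite mulnC -sum_nat_const; apply: eq_bigr => e /imsetP[[x y]].
rewrite inE /= => xy ->.
have x_neq_y : x != y by apply: contraTneq xy => ->; rewrite adj_irr.
rewrite (eq_bigl (mem [set (x, y); (y, x)])); last first.
  move=> [u v] /=; rewrite !inE /= !xpair_eqE.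
  apply/andP/orP => [[uv /eqP E]|[] /andP[/eqP-> /eqP->]]; last 2 first.
  - by rewrite xy eqxx.
  - by rewrite adj_sym xy setUC eqxx.
  have u_neq_v : u != v by apply: contraTneq uv => ->; rewrite adj_irr.
  have := set21 u v; rewrite E !inE => /orP[] /eqP Eu; subst u.
    left; have := set22 x v; rewrite E !inE eqxx => /orP[] // /eqP Ev.
    by rewrite Ev eqxx in u_neq_v.
  right; have := set22 y v; rewrite E !inE eqxx => /orP[->|/eqP Ev] //.
  by rewrite Ev eqxx in u_neq_v.
by rewrite sum1_card cards2 xpair_eqE negb_and x_neq_y.
Qed.

Section CrossGraph.
Variables (a b : nat) (H : sgraph) (F : {set H * 'I_b}).
Let G := cross_graph a F.

Definition cross_degree (x : H) : nat := #|[set y | (x, y) \in F]|.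

Definition inW (w : 'I_a) : cross_graph a F := inl w.
Definition inY (y : 'I_b) : cross_graph a F := inr (inr y).

Lemma big_cross (S : nmodType) (P : pred G) (g : G -> S) :
  (\sum_(v : G | P v) g v =
   \sum_(w | P (inW w)) g (inW w) + \sum_(x | P (inX a F x)) g (inX a F x)
   + \sum_(y | P (inY y)) g (inY y))%R.
Proof. by rewrite big_sumType (@big_sumType _ _ _ H 'I_b) /= addrA. Qed.

Lemma cross_adjE :
  (forall w w', adj (inW w) (inW w') = (w != w')) *
  (forall w x, (adj (inW w) (inX a F x) = true) *
               (adj (inX a F x) (inW w) = true)) *
  (forall w y, (adj (inW w) (inY y) = true) * (adj (inY y) (inW w) = true)) *
  (forall x x', adj (inX a F x) (inX a F x') = adj x x') *
  (forall x y, (adj (inX a F x) (inY y) = ((x, y) \in F)) *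
               (adj (inY y) (inX a F x) = ((x, y) \in F))) *
  (forall y y', adj (inY y) (inY y') = (y != y')).
Proof.
by rewrite /= /cross_adj /=; do !split=> *; rewrite /= ?orbF //.
Qed.

Lemma sum_cross_degree : (\sum_x cross_degree x = #|F|)%N.
Proof.
rewrite -sum1_card (eq_bigl (fun p => xpredT p.1 && ((p.1, p.2) \in F)));
  last by case.
rewrite -(pair_big_dep xpredT (fun x y => (x, y) \in F) (fun _ _ => 1%N)) /=.
apply: eq_bigr => x _; rewrite /cross_degree -sum1_card.
by apply: eq_bigl => y; rewrite inE.
Qed.

Lemma degree_inX x : degree (inX a F x) = (a + degree x + cross_degree x)%N.
Proof.
rewrite /degree -sum1_card big_cross.
under eq_bigl do rewrite inE cross_adjE.
under [X in (_ + X + _)%R]eq_bigl do rewrite inE cross_adjE.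
under [X in (_ + _ + X)%R]eq_bigl do rewrite inE cross_adjE.
rewrite !sum1_card card_ord.
by congr (_ + _ + _)%N; apply: eq_card => y; rewrite inE.
Qed.

End CrossGraph.

Lemma bin2_double (h : nat) : 'C(2 * h + 2, 2) = ((h + 1) * (2 * h + 1))%N.
Proof.
rewrite bin2 (_ : (2 * h + 2).-1 = 2 * h + 1)%N; last lia.
rewrite (_ : _ * _ = ((h + 1) * (2 * h + 1)).*2)%N; last lia.
by rewrite doubleK.
Qed.

(** Every vertex of X is adjacent to the a vertices of W, so that the degree
    condition says that degree x + f x >= 2h + 1.  Summed over X, both sides
    are equal: the h edges missing in H are made up for by the 2h edges
    of F. *)
Lemma family_cross_degree (h k b : nat) (H : sgraph) (F : {set H * 'I_b}) :
  (h + 1 <= k)%N -> #|H| = (2 * h + 2)%N ->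
  #|edges H| = ('C(2 * h + 2, 2) - h)%N -> #|F| = (2 * h)%N ->
  (forall x : H, (k + h <= degree (inX (k - h - 1) F x))%N) ->
  forall x, (degree x + cross_degree F x = 2 * h + 1)%N.
Proof.
move=> hk HX HE cardF deg_ge.
have le_x x : (2 * h + 1 <= degree x + cross_degree F x)%N.
  by have := deg_ge x; rewrite degree_inX; lia.
have sum_eq : (\sum_(x : H) (degree x + cross_degree F x) =
               \sum_(x : H) (2 * h + 1))%N.
  rewrite big_split /= sum_degree sum_cross_degree HE cardF sum_nat_const HX.
  by rewrite bin2_double; nia.
move=> x; apply/eqP; rewrite eqn_leq le_x andbT leqNgt; apply/negP => lt_x.
move: sum_eq; rewrite (bigD1 x) //= [in RHS](bigD1 x) //= => E.
have : (\sum_(i | i != x) (2 * h + 1) <=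
        \sum_(i | i != x) (degree i + cross_degree F i))%N.
  by apply: leq_sum => y _; apply: le_x.
lia.
Qed.

(** * The five classes *)

Lemma kept_inj a : injective (@kept a).
Proof. by case: a => [|a] //=; apply: lift_inj. Qed.

Lemma mem_kept a (i : 'I_5) :
  reflect (exists j, @kept a j = i) ((i != 2 :> nat) || (0 < a)%N).
Proof.
case: a => [|a]; rewrite ?orbT ?orbF; last by apply: ReflectT; exists i.
apply: (iffP idP) => [i2|[j <-]]; last first.
  by rewrite eq_sym; apply: (neq_lift (Ordinal (isT : 2 < 5)) j).
have [|j ->] := @unlift_some _ (Ordinal (isT : 2 < 5)) i.
  by rewrite eq_sym.
by exists j.
Qed.

(** The five classes in any graph where each vertex of X has at most one
    neighbour in Y: U consists of the vertices of X with one neighbour in Y, I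
    of those with none, and Z is any set of 2h vertices of Y that contains all
    the neighbours of X. *)
Section TightClasses.
Variables (a b h : nat) (H : sgraph) (F : {set H * 'I_b}) (Z : {set 'I_b}).

(** Positions in the order U, I, W, Z, Y0.  The values are natural numbers
    because comparisons with a given class then compute. *)
Definition class_index (v : cross_graph a F) : nat :=
  match v with
  | inl _ => 2
  | inr (inl x) => if cross_degree F x == 0 then 1 else 0
  | inr (inr y) => if y \in Z then 3 else 4
  end.

Definition class_counts (i j : 'I_5) : nat :=
  nth 0 (nth [::]
    [:: [:: 2 * h - 2; 2; a;     1;         0        ];
        [:: 2 * h;     1; a;     0;         0        ];
        [:: 2 * h;     2; a - 1; 2 * h;     b - 2 * h];
        [:: 1;         0; a;     2 * h - 1; b - 2 * h];
        [:: 0;         0; a;     2 * h;     b - 2 * h - 1]] i) j.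

Definition class_sizes (i : 'I_5) : nat :=
  nth 0 [:: 2 * h; 2; a; 2 * h; b - 2 * h] i.

Definition class_set (i : 'I_5) : {set cross_graph a F} :=
  [set v | class_index v == i].

Hypothesis cardH : #|H| = (2 * h + 2)%N.
Hypothesis deg_f : forall x : H, (degree x + cross_degree F x = 2 * h + 1)%N.
Hypothesis cardF : #|F| = (2 * h)%N.
Hypothesis f_le1 : forall x : H, (cross_degree F x <= 1)%N.
Hypothesis cardZ : #|Z| = (2 * h)%N.
Hypothesis F_Z : forall x y, (x, y) \in F -> y \in Z.

Let f0 (x : H) := cross_degree F x == 0.

(** The 2h edges of F have distinct ends in X. *)
Lemma card_cross1 : #|[set x | ~~ f0 x]| = (2 * h)%N.
Proof.
rewrite -cardF -sum_cross_degree -sum1_card [LHS]big_mkcond /=.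
apply: eq_bigr => x _; rewrite inE /f0.
by have := f_le1 x; case: cross_degree => [|[|]].
Qed.

Lemma card_cross0 : #|[set x | f0 x]| = 2.
Proof.
have := cardsC [set x : H | f0 x]; rewrite cardH.
rewrite (_ : ~: _ = [set x | ~~ f0 x]) ?card_cross1; first lia.
by apply/setP => x; rewrite !inE.
Qed.

(** A vertex without neighbour in Y has degree 2h + 1 = |X| - 1 in H. *)
Lemma adj_cross0 x y : f0 x -> adj x y = (x != y).
Proof.
move=> /eqP fx; have := deg_f x; rewrite fx addn0 => dx.
have sub : neighbors x \subset [set~ x].
  by apply/subsetP => z; rewrite !inE; apply: contraTneq => ->; rewrite adj_irr.
have /setP/(_ y) : neighbors x = [set~ x].
  apply/eqP; rewrite eqEcard sub cardsC1 cardH.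
  by move: dx; rewrite /degree => ->; lia.
by rewrite !inE eq_sym.
Qed.

Lemma card_adj_cross0 x : #|[set y | adj x y && f0 y]| = (2 - f0 x)%N.
Proof.
have [fx|fx] := boolP (f0 x).
  rewrite (_ : [set _ | _] = [set y | f0 y] :\ x); last first.
    by apply/setP => y; rewrite !inE adj_cross0 // eq_sym.
  have := cardsD1 x [set y | f0 y]; rewrite inE fx card_cross0; lia.
rewrite subn0 -card_cross0; apply: eq_card => y; rewrite !inE.
have [fy|fy] := boolP (f0 y); last by rewrite /= andbF.
by rewrite andbT adj_sym adj_cross0 //; apply: contraNneq fx => <-.
Qed.

(** A vertex of U has degree 2h in H, and both vertices of I are among its
    neighbours. *)
Lemma card_adj_cross1 x :
  #|[set y | adj x y && ~~ f0 y]| = (if f0 x then 2 * h else 2 * h - 2)%N.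
Proof.
have : degree x = (#|[set y | adj x y && f0 y]| +
                   #|[set y | adj x y && ~~ f0 y]|)%N.
  rewrite /degree -(cardsID [set y | f0 y] (neighbors x)).
  by congr addn; apply: eq_card => y; rewrite !inE // andbC.
rewrite card_adj_cross0; have := deg_f x; have := f_le1 x; rewrite /f0.
case: cross_degree => [|[|//]] /=; lia.
Qed.

(** The summands count the neighbours in W, in X and in Y; each list gives the
    classes that can meet that part, and [nth] returns 0 beyond its end. *)
Lemma card_neighbors_class_set v (j : 'I_5) :
  #|neighbors v :&: class_set j| =
  (nth 0 [:: 0; 0; #|[set w | adj v (inW F w)]|] j +
   nth 0 [:: #|[set x | adj v (inX a F x) && ~~ f0 x]|;
             #|[set x | adj v (inX a F x) && f0 x]|] j +
   nth 0 [:: 0; 0; 0; #|[set y | adj v (inY a F y) && (y \in Z)]|;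
             #|[set y | adj v (inY a F y) && (y \notin Z)]|] j)%N.
Proof.
rewrite -sum1_card big_cross; congr (_ + _ + _)%N.
- rewrite (eq_bigl (fun w => adj v (inW F w) && (2 == j :> nat))); last first.
    by move=> w; rewrite !inE.
  case: j => [[|[|[|[|[|//]]]]] lt_j] /=;
    first [by rewrite big_pred0 // => w; rewrite andbF
          |by rewrite -sum1_card; apply: eq_bigl => w; rewrite inE andbT].
- rewrite (eq_bigl (fun x => adj v (inX a F x) &&
      ((if f0 x then 1 else 0) == j))); last by move=> w; rewrite !inE.
  case: j => [[|[|[|[|[|//]]]]] lt_j] /=;
    first [by rewrite big_pred0 // => x; case: f0; rewrite andbF
          |by rewrite -sum1_card; apply: eq_bigl => x; rewrite inE; case: f0].
- rewrite (eq_bigl (fun y => adj v (inY a F y) &&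
      ((if y \in Z then 3 else 4) == j))); last by move=> w; rewrite !inE.
  case: j => [[|[|[|[|[|//]]]]] lt_j] /=;
    first [by rewrite big_pred0 // => y; case: ifP; rewrite andbF
          |by rewrite -sum1_card; apply: eq_bigl => y; rewrite inE; case: ifP].
Qed.

Lemma card_neq (T : finType) (x : T) (P : pred T) :
  #|[set y | (x != y) && P y]| = (#|P| - P x)%N.
Proof.
rewrite (_ : #|P| = #|[set y | P y]|); last by apply: eq_card => y; rewrite inE.
rewrite (cardsD1 x [set y | P y]) inE addKn; apply: eq_card => y.
by rewrite !inE eq_sym.
Qed.

Lemma card_Z : #|(fun y => y \in Z)| = (2 * h)%N.
Proof. by rewrite -cardZ; apply: eq_card. Qed.

Lemma card_notZ : #|(fun y => y \notin Z)| = (b - 2 * h)%N.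
Proof.
rewrite (_ : #|_| = #|~: Z|); last by apply: eq_card => y; rewrite inE.
by have := cardsC Z; rewrite card_ord cardZ; lia.
Qed.

(** The excluded pair is (Z, U): the edges of F may be distributed unevenly
    over Z, which is why the partition need not be equitable. *)
Lemma class_set_counts v (i j : 'I_5) : v \in class_set i ->
  ~~ ((i == 3 :> nat) && (j == 0 :> nat)) ->
  #|neighbors v :&: class_set j| = class_counts i j.
Proof.
have card_cross1' : #|(fun x => ~~ f0 x)| = (2 * h)%N.
  by rewrite -card_cross1; apply: eq_card => x; rewrite inE.
have card_cross0' : #|(fun x => f0 x)| = 2.
  by rewrite -card_cross0; apply: eq_card => x; rewrite inE.
rewrite inE /class_counts card_neighbors_class_set; case: v => [w|[x|y]].
- move=> /eqP <- _.
  rewrite (_ : #|[set w' | _]| = a - 1)%N; last first.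
    rewrite -[in RHS](card_ord a) -[RHS](card_neq w xpredT).
    by apply: eq_card => w'; rewrite !inE cross_adjE ?andbT.
  have Xw (P : pred H) : #|[set x | adj (inW F w) (inX a F x) && P x]| = #|P|.
    by apply: eq_card => x; rewrite !inE cross_adjE.
  have Yw (P : pred 'I_b) :
      #|[set y | adj (inW F w) (inY a F y) && P y]| = #|P|.
    by apply: eq_card => x; rewrite !inE cross_adjE.
  rewrite !Xw !Yw card_Z card_notZ card_cross0' card_cross1'.
  by case: j => [[|[|[|[|[|//]]]]] lt_j] /=; rewrite ?addn0.
- have fx : class_index (inX a F x) = if f0 x then 1 else 0 by [].
  rewrite fx => vi _.
  rewrite (_ : #|[set w | _]| = a); last first.
    by rewrite -[RHS]card_ord; apply: eq_card => w; rewrite !inE cross_adjE.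
  have Xx (P : pred H) : [set x' | adj (inX a F x) (inX a F x') && P x'] =
      [set x' | adj x x' && P x'].
    by apply/setP => x'; rewrite !inE cross_adjE.
  rewrite !Xx card_adj_cross0 card_adj_cross1.
  rewrite (_ : #|[set y | _ && (y \in Z)]| = cross_degree F x); last first.
    apply: eq_card => y; rewrite !inE cross_adjE.
    by apply: andb_idr; apply: F_Z.
  rewrite (_ : #|[set y | _]| = 0); last first.
    apply: eq_card0 => y; rewrite !inE cross_adjE.
    by apply/negP => /andP[/F_Z ->].
  have := f_le1 x; move: vi; rewrite /f0.
  case: cross_degree => [|[|//]] /= /eqP <- _;
    by case: j => [[|[|[|[|[|//]]]]] lt_j] /=; rewrite ?addn0.
- have fy : class_index (inY a F y) = if y \in Z then 3 else 4 by [].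
  rewrite fy => vi ij.
  rewrite (_ : #|[set w | _]| = a); last first.
    by rewrite -[RHS]card_ord; apply: eq_card => w; rewrite !inE cross_adjE.
  have Yy (P : pred 'I_b) : #|[set y' | adj (inY a F y) (inY a F y') && P y']|
      = (#|P| - P y)%N.
    by rewrite -card_neq; apply: eq_card => y'; rewrite !inE cross_adjE.
  rewrite !Yy card_Z card_notZ; cbv beta.
  rewrite (_ : #|[set x | _ && f0 x]| = 0); last first.
    apply: eq_card0 => x; rewrite !inE cross_adjE.
    apply/negP => /andP[xy /eqP/eqP]; rewrite cards_eq0 => /eqP/setP/(_ y).
    by rewrite !inE xy.
  have Xy : y \notin Z ->
      #|[set x | adj (inY a F y) (inX a F x) && ~~ f0 x]| = 0.
    move=> yZ; apply: eq_card0 => x; rewrite !inE cross_adjE.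
    by apply: contraNF yZ => /andP[/F_Z].
  move: vi ij Xy; case: (y \in Z) => /eqP <- ij Xy; last rewrite Xy //;
    by move: ij; case: j => [[|[|[|[|[|//]]]]] lt_j] /=; rewrite ?addn0 ?subn0.
Qed.

Lemma card_class_set (i : 'I_5) : #|class_set i| = class_sizes i.
Proof.
rewrite -sum1_card big_cross /class_sizes /class_set.
under eq_bigl do rewrite inE.
under [X in (_ + X + _)%R]eq_bigl do rewrite inE.
under [X in (_ + _ + X)%R]eq_bigl do rewrite inE.
have Wn (c : bool) : (\sum_(w < a | c) 1 = if c then a else 0)%N.
  case: c; last by rewrite big_pred0.
  by rewrite -[RHS]card_ord -sum1_card.
rewrite /= Wn.
have Xn (c1 c2 : bool) : (\sum_(x : H | if f0 x then c1 else c2) 1 =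
   (if c1 then 2 else 0) + (if c2 then 2 * h else 0))%N.
  rewrite (bigID f0) /= -{1}card_cross0 -card_cross1 -!sum1_card.
  congr addn; [case: c1 | case: c2].
  - by apply: eq_bigl => x; rewrite inE; case: f0; rewrite ?andbF.
  - by apply: big_pred0 => x; case: f0; rewrite ?andbF.
  - by apply: eq_bigl => x; rewrite inE; case: f0; rewrite ?andbF.
  - by apply: big_pred0 => x; case: f0; rewrite ?andbF.
have Yn (c1 c2 : bool) : (\sum_(y : 'I_b | if y \in Z then c1 else c2) 1 =
   (if c1 then 2 * h else 0) + (if c2 then b - 2 * h else 0))%N.
  rewrite (bigID (mem Z)) /= -card_notZ -card_Z -!sum1_card.
  congr addn; [case: c1 | case: c2].
  - apply: eq_bigl => x; rewrite [RHS]unfold_in.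
    by case: (x \in Z); rewrite ?andbF.
  - by apply: big_pred0 => x; case: (x \in Z); rewrite ?andbF.
  - apply: eq_bigl => x; rewrite [RHS]unfold_in.
    by case: (x \in Z); rewrite ?andbF.
  - by apply: big_pred0 => x; case: (x \in Z); rewrite ?andbF.
rewrite (eq_bigl (fun x => if f0 x then 1 == i :> nat else 0 == i :> nat));
  last by move=> x; rewrite /f0; case: ifP.
rewrite [X in (_ + _ + X)%R](eq_bigl
  (fun y => if y \in Z then 3 == i :> nat else 4 == i :> nat));
  last by move=> y; case: ifP.
rewrite Xn Yn.
by case: i => [[|[|[|[|[|//]]]]] lt_i] /=; lia.
Qed.

(** The pair (Z, U) is settled by counting the edges between Z and U from the
    side of U, where each vertex has exactly one neighbour in Z. *)
Lemma sum_class_counts (i j : 'I_5) :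
  (\sum_(v in class_set i) #|neighbors v :&: class_set j| =
   class_sizes i * class_counts i j)%N.
Proof.
have [/andP[/eqP i3 /eqP j0]|ij] := boolP ((i == 3 :> nat) && (j == 0 :> nat));
  last first.
  rewrite (eq_bigr (fun=> class_counts i j)) => [|v vi].
    by rewrite sum_nat_const card_class_set.
  exact: class_set_counts.
have -> : (\sum_(v in class_set i) #|neighbors v :&: class_set j| =
     \sum_(u in class_set j) #|neighbors u :&: class_set i|)%N.
  under eq_bigr do rewrite -sum1_card.
  under [RHS]eq_bigr do rewrite -sum1_card.
  rewrite (exchange_big_dep (mem (class_set j))) /=; last first.
    by move=> v u _; rewrite inE => /andP[].
  apply: eq_bigr => u uj; apply: eq_bigl => v; rewrite !inE in uj *.
  by rewrite uj andbT andbC adj_sym.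
rewrite (eq_bigr (fun=> class_counts j i)) => [|v vi]; last first.
  by apply: class_set_counts => //; rewrite j0.
rewrite sum_nat_const card_class_set /class_sizes /class_counts i3 j0 /=; lia.
Qed.

Lemma class_partition : (0 < h)%N -> (2 * h < b)%N ->
  is_partition (fun i : 'I_(nclasses a) => class_set (kept i)).
Proof.
move=> h_gt0 hb.
have size_gt0 (i : 'I_5) :
    (i != 2 :> nat) || (0 < a)%N -> (0 < class_sizes i)%N.
  by rewrite /class_sizes; case: i => [[|[|[|[|[|i]]]]] lt_i] //=; lia.
split=> [i|i j ij|].
- by rewrite -card_gt0 card_class_set size_gt0 //; apply/mem_kept; exists i.
- rewrite -setI_eq0; apply/eqP/setP => v; rewrite !inE.
  apply/negP => /andP[/eqP -> /eqP/val_inj/kept_inj ji].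
  by rewrite ji eqxx in ij.
apply/setP => v; rewrite inE; apply/bigcupP.
have lt_v : (class_index v < 5)%N by case: v => [|[x|y]] //=; case: ifP.
have /(@mem_kept a (Ordinal lt_v))[j jE] : (class_index v != 2) || (0 < a)%N.
  case: v {lt_v} => [w|[x|y]] /=; [|by case: ifP|by case: ifP].
  by case: (a) w => [[]|].
by exists j; rewrite // inE jE.
Qed.

End TightClasses.

(** * The minimal graph *)

Section MinimalGraphFacts.
Variables (h k n : nat).
Hypothesis h_gt0 : (0 < h)%N.
Hypothesis k_gt : (h < k)%N.
Hypothesis n_large : (2 * (k + h) + 2 <= n)%N.
Let b := (n - k - h - 1)%N.
Let F : {set minX h * 'I_b} := minF h k n.

Definition minZ : {set 'I_(n - k - h - 1)} :=
  [set y : 'I_(n - k - h - 1) | (y < 2 * h)%N].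

Lemma card_minX : #|minX h| = (2 * h + 2)%N.
Proof. by rewrite card_sum card_prod !card_ord card_bool mulnC. Qed.

Lemma minY_subproof (u : 'I_h * bool) : (2 * u.1 + u.2 < n - k - h - 1)%N.
Proof. by case: u => i c /=; have := ltn_ord i; case: c; lia. Qed.

Definition minY u : 'I_(n - k - h - 1) := Ordinal (minY_subproof u).

Lemma mem_minF x y : ((x, y) \in F) =
  (if x is inl u then y == minY u else false).
Proof. by rewrite inE /=; case: x => [[i c]|x]. Qed.

Lemma cross_degree_min (x : minX h) :
  cross_degree F x = (if x is inl _ then 1 else 0)%N.
Proof.
rewrite /cross_degree; case: x => [u|x]; last first.
  by apply: eq_card0 => y; rewrite inE mem_minF.
rewrite -[RHS](cards1 (minY u)); apply: eq_card => y.
by rewrite inE mem_minF inE.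
Qed.

Lemma degree_min (x : minX h) :
  degree x = (if x is inl _ then 2 * h else 2 * h + 1)%N.
Proof.
rewrite /degree; case: x => [[i c]|x].
  rewrite (_ : neighbors _ = ~: [set (inl (i, true) : minX h); inl (i, false)]).
    have tf : (inl (i, true) : minX h) != inl (i, false).
      by apply/eqP => - [].
    have := cardsC [set (inl (i, true) : minX h); inl (i, false)].
    by rewrite card_minX cards2 tf; lia.
  apply/setP => -[[j d]|y]; rewrite !inE /= /minX_adj /=.
    have [<-|ij] := eqVneq i j; first by case: d; rewrite andbF eqxx ?orbT.
    have neq c1 c2 : ((inl (i, c1) : minX h) == inl (j, c2)) = false.
      by apply/eqP => -[ij' _]; rewrite ij' eqxx in ij.
    by rewrite neq !(eq_sym (inl (j, d))) !neq.
  by [].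
rewrite (_ : neighbors _ = [set~ (inr x : minX h)]).
  by rewrite cardsC1 card_minX; lia.
by apply/setP => -[u|y]; rewrite !inE /= /minX_adj ?andbT //= eq_sym.
Qed.

Lemma deg_sum_min (x : minX h) : (degree x + cross_degree F x = 2 * h + 1)%N.
Proof. by rewrite degree_min cross_degree_min; case: x; lia. Qed.

Lemma card_minF : #|F| = (2 * h)%N.
Proof.
rewrite -sum_cross_degree; under eq_bigr do rewrite cross_degree_min.
by rewrite big_sumType /= !sum_nat_const card_prod card_ord card_bool; lia.
Qed.

Lemma card_edges_minX : #|edges (minX h)| = ('C(2 * h + 2, 2) - h)%N.
Proof.
have := sum_degree (minX h); under eq_bigr do rewrite degree_min.
rewrite big_sumType /= !sum_nat_const card_prod !card_ord card_bool.
by rewrite bin2_double; nia.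
Qed.

Lemma connected_minX : connected (minX h).
Proof.
split=> [|x y]; first by rewrite card_minX; lia.
pose z : minX h := inr ord0.
have zc (t : minX h) : connect (@adj (minX h)) t z.
  have [->|tz] := eqVneq t z; first exact: connect0.
  by apply: connect1; case: t tz => [[i c]|t] tz; apply/andP; split.
by apply: connect_trans (zc x) _; rewrite (sym_connect_sym (@adj_sym (minX h))).
Qed.

Lemma Gmin_family : family_L2H n k (k + h) (Gmin h k n).
Proof.
rewrite /family_L2H addKn; exists (minX h), F; split.
- exact: card_minX.
- exact: connected_minX.
- exact: card_edges_minX.
- split=> [|x]; first exact: card_minF.
  by rewrite degree_inX -addnA deg_sum_min; lia.
- by exists id; split=> //; exists id.
Qed.

Lemma card_minZ : #|minZ| = (2 * h)%N.
Proof.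
have le_hb : (2 * h <= n - k - h - 1)%N by lia.
have inj : injective (widen_ord le_hb) by move=> i j [] /val_inj.
rewrite -[RHS]card_ord -(card_imset _ inj).
apply: eq_card => y; rewrite inE.
apply/idP/imsetP => [yh|[j _ ->]]; last exact: (ltn_ord j).
by exists (Ordinal yh) => //; apply: val_inj.
Qed.

Lemma minF_minZ x y : (x, y) \in F -> y \in minZ.
Proof.
rewrite mem_minF inE; case: x => // -[i c] /eqP -> /=.
by have := ltn_ord i; case: c; lia.
Qed.

Lemma classes5E (i : 'I_5) : classes5 h k n i = class_set (k - h - 1) F minZ i.
Proof.
have UE v : (v \in classU h k n) =
      (if v is inr (inl (inl u)) then true else false).
  apply/imsetP/idP => [[u _ ->] //|]; case: v => [w|[[u|x]|y]] // _.
  by exists u.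
have IE v : (v \in classI h k n) =
      (if v is inr (inl (inr u)) then true else false).
  apply/imsetP/idP => [[u _ ->] //|]; case: v => [w|[[u|x]|y]] // _.
  by exists x.
have WE v : (v \in classW h k n) = (if v is inl u then true else false).
  apply/imsetP/idP => [[u _ ->] //|]; case: v => [w|[[u|x]|y]] // _.
  by exists w.
have YE v : (v \in classY h k n) = (if v is inr (inr u) then true else false).
  apply/imsetP/idP => [[u _ ->] //|]; case: v => [w|[[u|x]|y]] // _.
  by exists y.
have ZE v : (v \in classZ h k n) =
      (if v is inr (inr y) then (y < 2 * h)%N else false).
  apply/imsetP/idP => [[u + ->]|]; first by rewrite inE.
  case: v => [w|[[u|x]|y]] // y2.
  by exists y; rewrite ?inE.
apply/setP => v; rewrite [RHS]inE.
case: i => [[|[|[|[|[|//]]]]] lt_i] /=; 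
  rewrite /classes5 /= ?inE ?UE ?IE ?WE ?ZE ?YE; case: v => [w|[[u|x]|y]] //=;
  by rewrite ?cross_degree_min ?inE //; case: ifP.
Qed.

(** Here the pair (Z, U) is regular too: the vertex y of Z is only joined to
    the vertex of U with coordinates (y / 2, odd y). *)
Lemma min_counts (i j : 'I_5) v : v \in classes5 h k n i ->
  #|neighbors v :&: classes5 h k n j| = class_counts (k - h - 1) b h i j.
Proof.
rewrite !classes5E => vi.
have f_le1 (x : minX h) : (cross_degree F x <= 1)%N.
  by rewrite cross_degree_min; case: x.
have [/andP[/eqP i3 /eqP j0]|ij] := boolP ((i == 3 :> nat) && (j == 0 :> nat));
  last first.
  exact: (class_set_counts card_minX deg_sum_min card_minF f_le1 card_minZ
    minF_minZ).
rewrite /class_counts (card_neighbors_class_set minZ) i3 j0 /=.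
move: vi; rewrite inE i3; case: v => [w|[x|y]] //=; first by case: ifP.
case: ifP => // yZ _; rewrite /= inE in yZ.
have lt_y2 : (y./2 < h)%N by lia.
pose u : minX h := inl (Ordinal lt_y2, odd y).
rewrite add0n addn0 -[RHS](cards1 u); apply: eq_card => x.
rewrite !inE.
rewrite -[cross_adj _ _ _]/(adj (inY (k - h - 1) F y) (inX (k - h - 1) F x)).
rewrite cross_adjE mem_minF cross_degree_min.
case: x => [[i' c]|x] //=; rewrite andbT; apply/eqP/eqP => [yE|[-> ->]].
  have yE' : val y = (2 * i' + c)%N by rewrite yE.
  have i'E : i' = Ordinal lt_y2.
    by apply: val_inj => /=; case: c yE' {yE} => /=; lia.
  have cE : c = odd y by case: c yE' {yE} => /=; lia.
  by rewrite /u i'E cE.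
by apply: val_inj; rewrite /= -[LHS]odd_double_half -mul2n addnC.
Qed.

(** The truncated subtractions of [class_counts] are exact: h and b - 2h are
    positive, and so is a as soon as the class W is kept. *)
Lemma QminE (R : realType) : Qmin h k n R =
  (\matrix_(i, j) (class_counts (k - h - 1) b h (kept i) (kept j))%:R)%R.
Proof.
apply/matrixP => i j; rewrite !mxE /class_counts.
have : (kept i != 2 :> nat) || (0 < k - h - 1)%N by apply/mem_kept; exists i.
have -> : qmin h k n = (b - 2 * h)%N by rewrite /qmin /b; lia.
case: (kept i) => [[|[|[|[|[|//]]]]] lt_i] /= a_gt0;
 case: (kept j) => [[|[|[|[|[|//]]]]] lt_j] //=;
 by rewrite [RHS]natrB //; rewrite /b; lia.
Qed.

Lemma min_quotient_mx (R : realType) :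
  is_quotient_mx (@min_classes h k n) (Qmin h k n R).
Proof.
exists (fun i j => class_counts (k - h - 1) b h (kept i) (kept j)).
  by move=> i j x; apply: min_counts.
exact: QminE.
Qed.

Lemma min_partition : is_partition (@min_classes h k n).
Proof.
have f_le1 (x : minX h) : (cross_degree F x <= 1)%N.
  by rewrite cross_degree_min; case: x.
have hb : (2 * h < b)%N by rewrite /b; lia.
have [V0 V_disj V_cov] := class_partition (k - h - 1) card_minX card_minF
  f_le1 card_minZ h_gt0 hb.
split=> [i|i j|]; rewrite /min_classes ?classes5E; [exact: V0|exact: V_disj|].
by rewrite -V_cov; apply: eq_bigr => i _; rewrite classes5E.
Qed.

Lemma card_min_classes i : #|@min_classes h k n i| = @min_sizes h k n i.
Proof.
have f_le1 (x : minX h) : (cross_degree F x <= 1)%N.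
  by rewrite cross_degree_min; case: x.
rewrite /min_classes classes5E.
rewrite (card_class_set _ card_minX card_minF f_le1 card_minZ).
rewrite /class_sizes /min_sizes /sizes5; congr (nth _ [:: _; _; _; _; _] _).
by rewrite /qmin; lia.
Qed.

End MinimalGraphFacts.

Local Open Scope ring_scope.

(** * Spectral radius of a real matrix *)

Section Spectrum.
Variable R : realType.
Local Open Scope complex_scope.

Lemma normr_complexE (z : R[i]) : `|z| = (Normc.normc z)%:C.
Proof. by rewrite normc_def; case: z. Qed.

Lemma spectral_radius_ge0 (n : nat) (A : 'M[R]_n) : 0 <= spectral_radius A.
Proof.
rewrite /spectral_radius; elim/big_rec: _ => // z x _ x_ge0.
by rewrite le_max x_ge0 orbT.
Qed.

Lemma eigenvalue_le_radius (n : nat) (A : 'M[R]_n) (z : R[i]) :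
  eigenvalue (complex_mx A) z -> `|z| <= (spectral_radius A)%:C.
Proof.
rewrite -mem_spectrum normr_complexE lecR /spectral_radius => zA.
exact: (@le_bigmax_seq _ _ _ _ 0 z xpredT (@Normc.normc R)).
Qed.

Lemma spectral_radius_le (n : nat) (A : 'M[R]_n) (r : R) : 0 <= r ->
  (forall z, eigenvalue (complex_mx A) z -> `|z| <= r%:C) ->
  spectral_radius A <= r.
Proof.
move=> r_ge0 Ar; rewrite /spectral_radius big_seq.
elim/big_rec: _ => // z x zA x_le; rewrite ge_max x_le andbT -lecR.
by rewrite -normr_complexE Ar // -mem_spectrum.
Qed.

(** The second case of the proof is there because the maximum that defines the
    radius starts from 0: if it is 0, every eigenvalue attains it. *)
Lemma spectral_radius_attained (n : nat) (A : 'M[R]_n) : (0 < n)%N ->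
  exists2 z, eigenvalue (complex_mx A) z & `|z| = (spectral_radius A)%:C.
Proof.
move=> n_gt0.
have [z0 z0A] := eigenvalue_closed (complex_mx A) n_gt0.
have [[z zA Ez]|r0] : (exists2 z, z \in spectrum A &
    Normc.normc z = spectral_radius A) \/ spectral_radius A = 0.
- rewrite /spectral_radius; elim: (spectrum A) => [|z s IH].
    by right; rewrite big_nil.
  left; rewrite big_cons; set b := \big[_/_]_(_ <- _) _ in IH *.
  have [le_zb|lt_bz] := leP (Normc.normc z) b; last first.
    by exists z; rewrite ?mem_head.
  case: IH => [[t ts tE]|b0]; first by exists t; rewrite ?inE ?ts ?orbT.
  exists z; rewrite ?mem_head //; apply/le_anti; rewrite le_zb b0.
  by rewrite -lecR -normr_complexE normr_ge0.
- by exists z; rewrite -?mem_spectrum // normr_complexE Ez.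
exists z0 => //; apply/le_anti; rewrite eigenvalue_le_radius //=.
by rewrite r0 normr_ge0.
Qed.

End Spectrum.

Section Symmetric.
Variable R : realType.
Local Open Scope complex_scope.
Local Open Scope sesquilinear_scope.

(** Let u be a left eigenvector for z.  Then |z| |u| <= |u| B entrywise, and
    pairing with v gives |z| (|u| v) <= |u| B v <= r (|u| v), where |u| v > 0
    because v is positive. *)
Lemma nonneg_subeigenvalue_le (n : nat) (B : 'M[R]_n) (v : 'cV[R]_n) (r : R) :
  (forall i j, 0 <= B i j) -> (forall i, 0 < v i 0) ->
  (forall i, (B *m v) i 0 <= r * v i 0) ->
  forall z, eigenvalue (complex_mx B) z -> `|z| <= r%:C.
Proof.
move=> B_ge0 v_gt0 Bv z /eigenvalueP [u uB u_neq0].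
pose s := \sum_i `|u 0 i| * (v i 0)%:C.
have s_gt0 : 0 < s.
  have [i ui] : exists i, u 0 i != 0 by apply/rV0Pn.
  rewrite /s (bigD1 i) //= ltr_pwDl //.
    by rewrite mulr_gt0 ?normr_gt0 // ltcR.
  by apply: sumr_ge0 => j _; rewrite mulr_ge0 // lecR ltW.
rewrite -(ler_pM2r s_gt0).
have -> : `|z| * s = \sum_i `|(z *: u) 0 i| * (v i 0)%:C.
  by rewrite mulr_sumr; apply: eq_bigr => i _; rewrite mxE normrM mulrA.
rewrite -uB; apply: (@le_trans _ _
  (\sum_i (\sum_j `|u 0 j| * (B j i)%:C) * (v i 0)%:C)).
  apply: ler_sum => i _; rewrite ler_wpM2r ?lecR ?(ltW (v_gt0 i)) // mxE.
  apply: le_trans (ler_norm_sum _ _ _) _; apply: ler_sum => j _.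
  by rewrite normrM mxE [X in _ * X]ger0_norm // lecR.
under eq_bigr do rewrite mulr_suml.
rewrite exchange_big /= /s mulr_sumr; apply: ler_sum => j _.
have -> : \sum_i `|u 0 j| * (B j i)%:C * (v i 0)%:C =
          `|u 0 j| * ((B *m v) j 0)%:C.
  rewrite mxE rmorph_sum mulr_sumr; apply: eq_bigr => i _.
  by rewrite rmorphM mulrA.
by rewrite mulrCA ler_wpM2l // -rmorphM lecR.
Qed.

Lemma symmetric_diagonalization (n : nat) (A : 'M[R]_n) : A^T = A ->
  exists (P : 'M[R[i]]_n) (d : 'I_n -> R),
  [/\ P \is unitarymx, forall i, d i <= spectral_radius A
    & complex_mx A = P^t* *m diag_mx (\row_i (d i)%:C) *m P].
Proof.
move=> A_sym; set Ac := complex_mx A.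
have Ac_herm : Ac \is hermsymmx.
  apply: realsym_hermsym.
    apply/is_hermitianmxP; rewrite expr0 scale1r map_mx_id //.
    by rewrite /Ac /complex_mx map_trmx A_sym.
  by apply/mxOverP => i j; rewrite mxE; apply/complex_realP; exists (A i j).
have [P [D [P_unit D_real AcE]]] : exists (P : 'M_n) (D : 'rV_n),
    [/\ P \is unitarymx, D \is a realmx & Ac = P^t* *m diag_mx D *m P].
  exists (spectralmx Ac), (spectral_diag Ac).
  rewrite spectral_unitarymx hermitian_spectral_diag_real //; split=> //.
  rewrite -invmx_unitary ?spectral_unitarymx //.
  exact/orthomx_spectralP/hermitian_normalmx.
have D0_real i : D 0 i \is Num.real by apply: (mxOverP D_real).
have DE : \row_i (complex.Re (D 0 i))%:C = D.
  by apply/rowP => i; rewrite mxE RRe_real.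
exists P, (fun i => complex.Re (D 0 i)).
split; [exact: P_unit | move=> i | by rewrite DE -AcE].
rewrite -lecR RRe_real //.
apply: le_trans (real_ler_norm (D0_real i)) _; apply: eigenvalue_le_radius.
apply/eigenvalueP; exists (row i P).
  have PAc : P *m Ac = diag_mx D *m P.
    by rewrite {1}AcE !mulmxA (unitarymxP P_unit) mul1mx.
  by rewrite -row_mul PAc row_mul row_diag_mx -scalemxAl -rowE.
apply/eqP => Pi0; have /row_unitarymxP/(_ i i) := P_unit.
by rewrite Pi0 linear0l eqxx => /eqP; rewrite eq_sym oner_eq0.
Qed.

(** In an orthonormal eigenbasis both sides are sums of squares weighted by
    the eigenvalues d i and by the radius, so that equality forces the
    coordinates of v to vanish wherever d i differs from the radius. *)
Lemma rayleigh (n : nat) (A : 'M[R]_n) (v : 'rV[R]_n) : A^T = A ->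
  (v *m A *m v^T) 0 0 <= spectral_radius A * (v *m v^T) 0 0
    ?= iff (v *m A == spectral_radius A *: v).
Proof.
move=> /symmetric_diagonalization[P [d [P_unit d_le AE]]].
set rho := spectral_radius A in d_le *.
pose vc := map_mx (real_complex R) v.
have [w wE vcE] : exists2 w, w = vc *m P^t* & vc = w *m P.
  by exists (vc *m P^t*); rewrite // mulmxKtV.
have vc_conj : vc^t* = vc^T.
  apply/matrixP => i j; rewrite !mxE conj_Creal //.
  by apply/complex_realP; eexists.
have [e eE] : exists e : 'I_n -> R, forall i, (e i)%:C = w 0 i * (w 0 i)^*.
  exists (fun i => Normc.normc (w 0 i) ^+ 2) => i.
  by rewrite -normCK normr_complexE -rmorphXn.
have e_ge0 i : 0 <= e i by rewrite -lecR eE mul_conjC_ge0.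
have vvE : (v *m v^T) 0 0 = \sum_i e i.
  apply: complexI; rewrite rmorph_sum /=.
  transitivity ((vc *m vc^t*) 0 0).
    rewrite vc_conj !mxE rmorph_sum; apply: eq_bigr => i _.
    by rewrite !mxE rmorphM.
  rewrite vcE trmx_mul map_mxM mulmxA mulmxtVK // mxE.
  by apply: eq_bigr => i _; rewrite eE !mxE.
have vAvE : (v *m A *m v^T) 0 0 = \sum_i d i * e i.
  apply: complexI; rewrite rmorph_sum /=.
  transitivity ((vc *m complex_mx A *m vc^t*) 0 0).
    rewrite vc_conj map_trmx -!map_mxM /=.
    by rewrite [RHS]mxE.
  rewrite AE vcE trmx_mul map_mxM !mulmxA mulmxtVK // mulmxtVK // mxE.
  by apply: eq_bigr => i _; rewrite mul_mx_diag !mxE rmorphM /= eE mulrCA mulrA.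
have -> : (v *m A == rho *: v) = [forall i, d i * e i == rho * e i].
  have -> : (v *m A == rho *: v) =
      (w *m diag_mx (\row_i (d i)%:C) == rho%:C *: w).
    have vAE : vc *m complex_mx A = w *m diag_mx (\row_i (d i)%:C) *m P.
      by rewrite AE !mulmxA -wE.
    have vrE : rho%:C *: vc = rho%:C *: w *m P by rewrite -scalemxAl -vcE.
    apply/eqP/eqP => [vA|wD].
      rewrite -[LHS](mulmxtVK _ P_unit) -vAE /complex_mx /vc -map_mxM vA.
      by rewrite map_mxZ vrE mulmxtVK.
    apply: (@map_mx_inj _ _ (real_complex R)).
    by rewrite map_mxM map_mxZ /= -/vc vrE -wD.
  apply/eqP/forallP => [/rowP wD i|de].
    have := wD i; rewrite mul_mx_diag !mxE mulrC.
    move=> /(congr1 (fun z => z * (w 0 i)^*)).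
    by rewrite -!mulrA -eE -!rmorphM => /complexI/eqP.
  apply/rowP => i; rewrite mul_mx_diag !mxE mulrC.
  have /eqP/(congr1 (real_complex R)) := de i; rewrite !rmorphM /= eE.
  have [-> | wi0] := eqVneq (w 0 i) 0; first by rewrite !mulr0.
  by rewrite !mulrA => /(mulIf _); apply; rewrite conjC_eq0.
rewrite vvE vAvE mulr_sumr; apply: leif_sum => i _.
by split=> //; rewrite ler_wpM2r.
Qed.

(** The entrywise absolute value of an eigenvector for an eigenvalue of maximal
    modulus attains the Rayleigh bound, hence is an eigenvector itself. *)
Lemma nonneg_symmetric_perron (n : nat) (A : 'M[R]_n) : A^T = A ->
  (forall i j, 0 <= A i j) -> (0 < n)%N ->
  exists v : 'rV[R]_n, [/\ v != 0, forall i, 0 <= v 0 i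
    & v *m A = spectral_radius A *: v].
Proof.
move=> A_sym A_ge0 n_gt0; set rho := spectral_radius A.
have [z /eigenvalueP[u uA u_neq0] zE] := spectral_radius_attained A n_gt0.
have [v vE] : exists v : 'rV[R]_n, forall i, (v 0 i)%:C = `|u 0 i|.
  by exists (\row_i Normc.normc (u 0 i)) => i; rewrite mxE normr_complexE.
have v_ge0 i : 0 <= v 0 i by rewrite -lecR vE normr_ge0.
have vA i : rho * v 0 i <= (v *m A) 0 i.
  rewrite -lecR rmorphM /= vE -zE -normrM.
  have -> : z * u 0 i = (u *m complex_mx A) 0 i by rewrite uA mxE.
  rewrite !mxE rmorph_sum; apply: le_trans (ler_norm_sum _ _ _) _.
  apply: ler_sum => j _.
  by rewrite normrM rmorphM /= vE mxE [X in _ * X]ger0_norm // lecR.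
exists v; split=> //.
  have [i ui] : exists i, u 0 i != 0 by apply/rV0Pn.
  apply/rV0Pn; exists i; rewrite -(inj_eq (@complexI R)) vE normr_eq0 //.
apply/eqP; rewrite -(rayleigh v A_sym) eq_le rayleigh //=.
have -> : (v *m v^T) 0 0 = \sum_i v 0 i * v 0 i.
  by rewrite mxE; apply: eq_bigr => i _; rewrite !mxE.
rewrite mulr_sumr mxE; apply: ler_sum => i _.
by rewrite [v^T _ _]mxE mulrA ler_wpM2r.
Qed.

End Symmetric.

(** * Spectral radius of a graph *)

Lemma eigenvalue_right (F : fieldType) (n : nat) (A : 'M[F]_n) (a : F) :
  eigenvalue A a -> exists2 u : 'cV_n, A *m u = a *: u & u != 0.
Proof.
rewrite /eigenvalue /eigenspace kermx_eq0 -row_leq_rank -mxrank_tr row_leq_rank.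
rewrite -kermx_eq0 => /rowV0Pn[u /sub_kermxP uA u_neq0].
exists u^T; last by rewrite trmx_eq0.
apply/eqP; rewrite -subr_eq0 -mul_scalar_mx -mulmxBl.
by rewrite -[A - _]trmxK -trmx_mul uA trmx0.
Qed.

Section GraphRadius.
Variable R : realType.
Local Open Scope complex_scope.
Implicit Types (G : sgraph) (r : R).

Lemma adjacency_mx_sym G : (adjacency_mx R G)^T = adjacency_mx R G.
Proof. by apply/matrixP => i j; rewrite !mxE adj_sym. Qed.

Lemma adjacency_mx_ge0 G i j : 0 <= adjacency_mx R G i j.
Proof. by rewrite mxE ler0n. Qed.

Lemma graph_radius_ge0 G : 0 <= graph_radius R G.
Proof. exact: spectral_radius_ge0. Qed.

Lemma sum_enum_val (S : nmodType) G (f : G -> S) :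
  \sum_(i < #|G|) f (enum_val i) = \sum_x f x.
Proof.
by rewrite [RHS](reindex _ (onW_bij _ (@enum_val_bij G))).
Qed.

Lemma mul_adjacency_mx (S : pzRingType) G (f : G -> S) (i : 'I_#|G|) :
  \sum_(j < #|G|) f (enum_val j) * (adj (enum_val j) (enum_val i))%:R =
  \sum_(y | adj (enum_val i) y) f y.
Proof.
rewrite (sum_enum_val (fun y => f y * (adj y (enum_val i))%:R)) [RHS]big_mkcond.
apply: eq_bigr => y _; rewrite adj_sym.
by case: adj; rewrite ?mulr1 ?mulr0.
Qed.

Lemma graph_rayleigh G (f : G -> R) :
  \sum_x f x * \sum_(y | adj x y) f y <= graph_radius R G * \sum_x f x ^+ 2.
Proof.
pose v : 'rV[R]_#|G| := \row_(i < #|G|) f (enum_val i).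
have [+ _] := rayleigh v (adjacency_mx_sym G); rewrite !mxE.
under [X in _ * X]eq_bigr do rewrite !mxE -expr2.
rewrite (sum_enum_val (fun x => f x ^+ 2)).
under eq_bigr => i _.
  rewrite !mxE mulrC; under eq_bigr do rewrite !mxE.
  rewrite mul_adjacency_mx.
over.
by rewrite (sum_enum_val (fun x => f x * \sum_(y | adj x y) f y)).
Qed.

(** Composing the test vector with the isomorphism changes neither sum, so that
    a bound found on G0 passes to every graph isomorphic to it. *)
Lemma le_graph_radius G G0 (f : G0 -> R) r : isomorphic G G0 ->
  0 < \sum_x f x ^+ 2 ->
  r * \sum_x f x ^+ 2 <= \sum_x f x * \sum_(y | adj x y) f y ->
  r <= graph_radius R G.
Proof.
move=> [g [g_bij g_adj]] f_gt0 rf; rewrite -(ler_pM2r f_gt0).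
apply: (le_trans rf); move: (graph_rayleigh (f \o g)) => /=.
have g_on : {on xpredT, bijective g} by apply: onW_bij.
rewrite [\sum_x f x ^+ 2](reindex g) // => gf; apply: le_trans gf.
rewrite (reindex g) //=; apply: ler_sum => x _.
rewrite (reindex g) //=; last exact: onW_bij.
by under eq_bigl do rewrite g_adj.
Qed.

Lemma graph_perron G : (0 < #|G|)%N ->
  exists f : G -> R, [/\ exists x, f x != 0, forall x, 0 <= f x
    & forall x, \sum_(y | adj x y) f y = graph_radius R G * f x].
Proof.
move=> /(nonneg_symmetric_perron (adjacency_mx_sym G) (@adjacency_mx_ge0 G)).
case=> v [/rV0Pn[i vi] v_ge0 vA]; pose f x := v 0 (enum_rank x).
exists f; split; first by exists (enum_val i); rewrite /f enum_valK.
  by move=> x; apply: v_ge0.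
move=> x; rewrite -[x]enum_rankK -mul_adjacency_mx {2}/f enum_valK.
move/rowP/(_ (enum_rank x)): vA; rewrite /graph_radius mxE [RHS]mxE => <-.
by apply: eq_bigr => j _; rewrite mxE /f enum_valK.
Qed.

Section Quotient.
Variables (G : sgraph) (m : nat) (V : 'I_m -> {set G}).
Hypothesis V_part : is_partition V.

Lemma partition_index :
  exists c : G -> 'I_m, forall x i, (x \in V i) = (c x == i).
Proof.
have [_ V_disj V_cov] := V_part.
have V_ex x : {i | x \in V i}.
  apply: sigW; have: x \in [set: G] by [].
  by rewrite -V_cov => /bigcupP[i _ xi]; exists i.
exists (fun x => sval (V_ex x)) => x i; case: (V_ex x) => j xj /=.
apply/idP/eqP => [xi|<- //]; apply/eqP/negPn/negP => ji.
by have /disjointFr/(_ xj) := V_disj _ _ ji; rewrite xi.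
Qed.

End Quotient.
End GraphRadius.

(** * Quotient matrices *)

Section Quotient.
Local Open Scope complex_scope.
Variables (R : realType) (G : sgraph) (m : nat) (V : 'I_m -> {set G}).
Variable Q : 'M[R]_m.
Hypothesis V_part : is_partition V.

Section Index.
Variable c : G -> 'I_m.
Hypothesis cE : forall x i, (x \in V i) = (c x == i).

Lemma class_index_surj i : exists x, c x = i.
Proof.
have [/(_ i)/set0Pn[x] + _ _] := V_part.
by rewrite cE => /eqP <-; exists x.
Qed.

Lemma card_neighbors_class x i :
  #|neighbors x :&: V i| = (\sum_(y | adj x y && (c y == i)) 1)%N.
Proof.
by rewrite sum1_card; apply: eq_card => y; rewrite !inE cE.
Qed.

Lemma sum_neighbors_class (S : pzRingType) (g : 'I_m -> S) x :
  \sum_(y | adj x y) g (c y) = \sum_i #|neighbors x :&: V i|%:R * g i.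
Proof.
rewrite (partition_big c xpredT) //=; apply: eq_bigr => i _.
rewrite card_neighbors_class natr_sum mulr_suml.
by apply: eq_bigr => y /andP[_ /eqP <-]; rewrite mul1r.
Qed.

End Index.

(** The lifted vector is constant on the classes; it is nonzero because no
    class is empty. *)
Lemma quotient_radius_le : is_quotient_mx V Q ->
  spectral_radius Q <= graph_radius R G.
Proof.
case: (partition_index V_part) => c cE [q Vq QE].
apply: spectral_radius_le => [|z]; first exact: graph_radius_ge0.
move=> /eigenvalue_right[u Qu u_neq0]; apply: eigenvalue_le_radius.
apply/eigenvalueP; exists (\row_(i < #|G|) u (c (enum_val i)) 0).
  apply/rowP => i; rewrite !mxE.
  under eq_bigr do rewrite !mxE rmorph_nat.
  rewrite (mul_adjacency_mx (fun x => u (c x) 0)).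
  rewrite (sum_neighbors_class cE (fun i => u i 0)).
  have /colP/(_ (c (enum_val i))) := Qu; rewrite !mxE => <-.
  apply: eq_bigr => j _; rewrite QE !mxE rmorph_nat (Vq (c (enum_val i))) //.
  by rewrite cE.
apply: contraNneq u_neq0 => /rowP u0; apply/eqP/colP => j.
have [x <-] := class_index_surj cE j.
by have := u0 (enum_rank x); rewrite !mxE enum_rankK.
Qed.

(** By symmetry of the adjacency relation, the sums of a Perron eigenvector
    over the classes form a left eigenvector of Q.  They do not all vanish,
    since the entries of the eigenvector are nonnegative. *)
Lemma quotient_perron : (0 < m)%N -> is_quotient_mx V Q ->
  eigenvalue Q (graph_radius R G).
Proof.
move=> m_gt0; case: (partition_index V_part) => c cE [q Vq QE].
have [x0 _] := class_index_surj cE (Ordinal m_gt0).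
have G_gt0 : (0 < #|G|)%N by apply/card_gt0P; exists x0.
have [f [[x fx] f_ge0 Af]] := graph_perron R G_gt0.
apply/eigenvalueP; exists (\row_i \sum_(y | c y == i) f y).
  apply/rowP => j; rewrite !mxE mulr_sumr.
  under [RHS]eq_bigr do rewrite -Af.
  rewrite (exchange_big_dep xpredT) //=.
  transitivity (\sum_y f y * (q (c y) j)%:R).
    rewrite [RHS](partition_big c xpredT) //=; apply: eq_bigr => i _.
    by rewrite !mxE QE mulr_suml !mxE; apply: eq_bigr => y /eqP ->.
  apply: eq_bigr => y _.
  rewrite -(Vq (c y) j y) ?cE // (card_neighbors_class cE) natr_sum mulr_sumr.
  by apply: eq_big => [z|z _]; rewrite ?mulr1 // andbC adj_sym.
apply/eqP => /rowP/(_ (c x)); rewrite !mxE => /eqP.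
rewrite psumr_eq0 // => /allP/(_ x); rewrite mem_index_enum eqxx => /(_ isT).
by rewrite (negPf fx).
Qed.

Lemma quotient_radiusE : (0 < m)%N -> is_quotient_mx V Q ->
  graph_radius R G = spectral_radius Q.
Proof.
move=> m_gt0 VQ; apply/le_anti; rewrite quotient_radius_le // andbT.
have := quotient_perron m_gt0 VQ; rewrite -(eigenvalue_map (real_complex R)).
move=> /eigenvalue_le_radius; rewrite -lecR ger0_norm ?lecR //.
exact: graph_radius_ge0.
Qed.

(** The quadratic form of the adjacency matrix at a vector that is constant on
    the classes only depends on the numbers of edges between classes, that is,
    on the averages. *)
Lemma averaged_quotient_le (G0 : sgraph) (r : R) : isomorphic G0 G ->
  (forall i j, \sum_(x in V i) #|neighbors x :&: V j|%:R = #|V i|%:R * Q i j) ->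
  eigenvalue Q r -> r <= graph_radius R G0.
Proof.
case: (partition_index V_part) => c cE isoG VQ /eigenvalue_right[u Qu u_neq0].
have cardV i : #|V i|%:R = \sum_(x | c x == i) 1 :> R.
  by rewrite -sum1_card natr_sum; apply: eq_bigl => x; rewrite cE.
apply: (@le_graph_radius _ _ _ (fun x => u (c x) 0)) => //.
  have [i ui] : exists i, u i 0 != 0.
    have /rV0Pn[j] : u^T != 0 by rewrite trmx_eq0.
    by rewrite mxE; exists j.
  have [x xi] := class_index_surj cE i.
  rewrite (bigD1 x) //= ltr_pwDl ?sumr_ge0 // => [|y _]; last exact: sqr_ge0.
  by rewrite xi exprn_even_gt0.
rewrite (partition_big c xpredT) //= mulr_sumr.
rewrite [leRHS](partition_big c xpredT) //=; apply: ler_sum => i _.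
have -> : \sum_(x | c x == i) u (c x) 0 ^+ 2 = #|V i|%:R * u i 0 ^+ 2.
  by rewrite cardV mulr_suml; apply: eq_bigr => x /eqP ->; rewrite mul1r.
have -> : \sum_(x | c x == i) u (c x) 0 * \sum_(y | adj x y) u (c y) 0 =
    u i 0 * \sum_j (\sum_(x in V i) #|neighbors x :&: V j|%:R) * u j 0.
  under [in RHS]eq_bigr do rewrite mulr_suml.
  rewrite exchange_big mulr_sumr /=.
  apply: eq_big => [x|x /eqP <-]; first by rewrite cE.
  by rewrite (sum_neighbors_class cE (fun i => u i 0)).
under [in leRHS]eq_bigr do rewrite VQ -mulrA.
rewrite -mulr_sumr.
have /colP/(_ i) := Qu; rewrite !mxE => ->.
by rewrite [leRHS](_ : _ = r * (#|V i|%:R * u i 0 ^+ 2)) //; ring.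
Qed.

End Quotient.

(** * Estimates for large graphs *)

Lemma sum_neq (V : zmodType) (I : finType) (i : I) (g : I -> V) :
  \sum_(j | i != j) g j = \sum_j g j - g i.
Proof.
apply/(addrI (g i)); rewrite addrCA subrr addr0 [RHS](bigD1 i) //=.
by congr (_ + _); apply: eq_bigl => j; rewrite eq_sym.
Qed.

Section LowerBound.
Variables (R : realType) (a b : nat) (H : sgraph) (F : {set H * 'I_b}).
Let m : R := (a + b)%:R.
Let d (x : H) : R := (a + cross_degree F x)%:R.

(** The test vector is 1 on the clique and (a + f x) / m at x, the value that
    an eigenvector for an eigenvalue close to m takes there to first order.
    Its Rayleigh quotient is at least (m (m - 1) + 2 S / m) / (m + S / m ^ 2);
    the adjacencies inside X are neglected. *)
Lemma cross_radius_ge (G : sgraph) (s : R) :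
  isomorphic G (cross_graph a F) -> (0 < a + b)%N ->
  0 <= s -> s <= \sum_x d x ^+ 2 -> s <= m ^+ 2 ->
  m - 1 + s / m ^+ 2 <= graph_radius R G.
Proof.
move=> isoG ab_gt0 s_ge0; set S := \sum_x d x ^+ 2 => sS sm.
have m_gt0 : 0 < m by rewrite ltr0n.
have m_neq0 : m != 0 by rewrite gt_eqF.
have mE : m = a%:R + b%:R by rewrite /m natrD.
pose g (v : cross_graph a F) : R := if v is inr (inl x) then d x / m else 1.
have g2 : \sum_v g v ^+ 2 = m + S / m ^+ 2.
  rewrite big_cross /= !expr1n !sumr_const !card_ord mE addrAC; congr (_ + _).
  by rewrite /S mulr_suml; apply: eq_bigr => x _; rewrite expr_div_n.
have S_ge0 : 0 <= S by apply: sumr_ge0 => x _; apply: sqr_ge0.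
apply: (le_graph_radius (f := g) isoG).
  by rewrite g2 ltr_pwDl // divr_ge0 // exprn_ge0 // ltW.
pose T := \sum_x d x / m.
have rowW w : \sum_(v | adj (inW F w) v) g v = m - 1 + T.
  rewrite big_cross; under eq_bigl do rewrite cross_adjE.
  under [X in _ + X + _]eq_bigl do rewrite cross_adjE.
  under [X in _ + _ + X]eq_bigl do rewrite cross_adjE.
  rewrite sum_neq /= !sumr_const !card_ord -/T mE; ring.
have rowX x : d x <= \sum_(v | adj (inX a F x) v) g v.
  rewrite big_cross; under eq_bigl do rewrite cross_adjE.
  under [X in _ + X + _]eq_bigl do rewrite cross_adjE.
  under [X in _ + _ + X]eq_bigl do rewrite cross_adjE.
  rewrite /= sumr_const card_ord.
  rewrite (eq_bigl (fun y => y \in [set y | (x, y) \in F])) => [|y]; last first.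
    by rewrite inE.
  rewrite sumr_const /d natrD lerD2r lerDl sumr_ge0 // => y _.
  by rewrite divr_ge0 // ?ler0n // ltW.
have rowY y : \sum_(v | adj (inY a F y) v) g v =
    m - 1 + \sum_(x | (x, y) \in F) d x / m.
  rewrite big_cross; under eq_bigl do rewrite cross_adjE.
  under [X in _ + X + _]eq_bigl do rewrite cross_adjE.
  under [X in _ + _ + X]eq_bigl do rewrite cross_adjE.
  rewrite sum_neq /= !sumr_const !card_ord mE; ring.
apply: (@le_trans _ _ (m * (m - 1) + S / m *+ 2)); last first.
  rewrite big_cross /=.
  under eq_bigr do rewrite rowW mul1r.
  under [X in _ + _ + X]eq_bigr do rewrite rowY mul1r.
  have -> : \sum_(y < b) (m - 1 + \sum_(x | (x, y) \in F) d x / m) =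
      (m - 1) *+ b + \sum_x d x / m * (cross_degree F x)%:R.
    rewrite big_split /= sumr_const card_ord (exchange_big_dep xpredT) //=.
    congr (_ + _); apply: eq_bigr => x _.
    rewrite (eq_bigl (fun y => y \in [set y | (x, y) \in F])) => [|y].
      by rewrite sumr_const mulr_natr.
    by rewrite inE.
  rewrite sumr_const card_ord.
  apply: (@le_trans _ _ ((m - 1 + T) *+ a + \sum_x d x / m * d x +
    ((m - 1) *+ b + \sum_x d x / m * (cross_degree F x)%:R))).
    have -> : \sum_x d x / m * d x = S / m.
      by rewrite /S mulr_suml; apply: eq_bigr => x _; rewrite expr2 mulrAC.
    have E : T *+ a + \sum_x d x / m * (cross_degree F x)%:R = S / m.
      rewrite /T -mulr_natl mulr_sumr -big_split /= /S mulr_suml.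
      by apply: eq_bigr => x _; rewrite {3}/d natrD; ring.
    rewrite le_eqVlt; apply/orP; left; apply/eqP.
    rewrite [S / m *+ 2]mulr2n -{1}E {1}mE; ring.
  apply: lerD => //; apply: lerD => //.
  by apply: ler_sum => x _; rewrite ler_wpM2l // divr_ge0 // ?ler0n // ltW.
rewrite g2 -subr_ge0.
have -> : m * (m - 1) + S / m *+ 2 - (m - 1 + s / m ^+ 2) * (m + S / m ^+ 2) =
    (S - s) / m + S / m ^+ 4 * (m ^+ 2 - s) by field; rewrite -mE.
apply: addr_ge0; first by apply: divr_ge0; rewrite ?subr_ge0 // ltW.
by rewrite mulr_ge0 ?divr_ge0 ?subr_ge0 ?exprn_ge0 // ltW.
Qed.

End LowerBound.

(** The inequalities say Q v <= r v, row by row, for v constant equal to alpha,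
    beta, omega, zeta and 1 on U, I, W, Z and Y0.  To first order in p = 1 / m,
    alpha and beta are the numbers of neighbours in the clique divided by m;
    the term K p ^ 2 leaves room in the rows of U and I for the adjacencies
    inside X.  On the clique the entry is 1 plus p times the sum of v over the
    neighbours in X, which is s on W, alpha on Z and 0 on Y0; the rows of the
    clique then all reduce to p (a s + t alpha) <= (S + 1) p ^ 2.  The left
    side is S p ^ 2 + K D p ^ 3, and K D p <= 1. *)
Lemma trial_vector_bounds (R : realType)
    (t a q m p S K D r alpha beta s omega zeta : R) :
  2 <= t -> 0 <= a -> m = a + t + q -> p = m^-1 ->
  S = t * (a + 1) ^+ 2 + 2 * a ^+ 2 ->
  K = (t + 2) * (a + 1) * (a + 2) -> D = t * (a + 1) + 2 * a ->
  K <= m -> K * D <= m ->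
  r = m - 1 + (S + 1) * p ^+ 2 ->
  alpha = (a + 1) * p + K * p ^+ 2 -> beta = a * p + K * p ^+ 2 ->
  s = t * alpha + 2 * beta -> omega = 1 + p * s -> zeta = 1 + p * alpha ->
  [/\ 0 < alpha, 0 < beta, 0 < omega, 0 < zeta &
  [/\ (t - 2) * alpha + 2 * beta + a * omega + 1 * zeta + 0 * 1 <= r * alpha,
  t * alpha + 1 * beta + a * omega + 0 * zeta + 0 * 1 <= r * beta,
  t * alpha + 2 * beta + (a - 1) * omega + t * zeta + q * 1 <= r * omega,
  1 * alpha + 0 * beta + a * omega + (t - 1) * zeta + q * 1 <= r * zeta &
  0 * alpha + 0 * beta + a * omega + t * zeta + (q - 1) * 1 <= r * 1]].
Proof.
move=> t_ge2 a_ge0 mE pE SE KE DE Km KDm rE alphaE betaE sE omegaE zetaE.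
have t_ge0 : 0 <= t by lra.
have S_ge0 : 0 <= S by rewrite SE addr_ge0 // mulr_ge0 ?sqr_ge0.
have K_ge1 : 1 <= K by rewrite KE !mulr_ege1 //; lra.
have K_gt0 : 0 < K by lra.
have m_gt0 : 0 < m by apply: lt_le_trans Km.
have p_gt0 : 0 < p by rewrite pE invr_gt0.
have mp : m * p = 1 by rewrite pE mulfV // gt_eqF.
have Kp : K * p <= 1 by rewrite -mp ler_pM2r.
have KDp : K * D * p <= 1 by rewrite -mp ler_pM2r.
have p_le1 : p <= 1 by rewrite -mp ler_peMl ?(ltW p_gt0) //; lra.
have Kp2_gt0 : 0 < K * p ^+ 2 by rewrite mulr_gt0 ?exprn_gt0.
have Kp2_le : K * p ^+ 2 <= p by rewrite expr2 mulrA ler_piMl // ltW.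
have ap_ge0 : 0 <= a * p by rewrite mulr_ge0 // ltW.
have alpha_gt0 : 0 < alpha by rewrite alphaE; lra.
have beta_gt0 : 0 < beta by rewrite betaE; lra.
have alpha_le : alpha <= (a + 2) * p by rewrite alphaE; lra.
have beta_le : beta <= (a + 2) * p by rewrite betaE; lra.
have s_gt0 : 0 < s by rewrite sE ltr_wpDl ?mulr_ge0 ?mulr_gt0 // ltW.
have s_le : s <= (t + 2) * (a + 2) * p.
  by rewrite sE -mulrA (mulrDl t) lerD // ler_wpM2l.
have as_le : s + a * s <= K * p.
  rewrite KE (_ : _ * p = (t + 2) * (a + 2) * p * (1 + a)); last ring.
  by rewrite -{1}[s]mulr1 [a * s]mulrC -mulrDr ler_wpM2r //; lra.
have ps_le : p * s <= s by rewrite ler_piMl // ltW.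
have pa_le : p * alpha <= alpha by rewrite ler_piMl // ltW.
have [eps epsE] : exists eps, eps = (S + 1) * p ^+ 2 by eexists.
rewrite -epsE in rE.
have eps_ge0 : 0 <= eps.
  by rewrite epsE; apply: mulr_ge0 (sqr_ge0 p); apply: addr_ge0 S_ge0 ler01.
have excess : p * (a * s + t * alpha) <= eps.
  rewrite (_ : p * _ = (S + K * D * p) * p ^+ 2).
    by rewrite epsE ler_wpM2r ?lerD2l ?sqr_ge0.
  rewrite sE alphaE betaE SE DE; ring.
have totalE : a * omega + t * zeta + q = m + p * (a * s + t * alpha).
  rewrite mE omegaE zetaE; ring.
(* Rows of the clique, for a vertex with sum u over its neighbours in X. *)
have clique u : 0 <= u ->
    a * omega + t * zeta + q + u <= (m + eps) * (1 + p * u).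
  move=> u_ge0; rewrite totalE [leRHS](_ : _ = m + eps + u + eps * (p * u)).
    have : 0 <= eps * (p * u) := mulr_ge0 eps_ge0 (mulr_ge0 (ltW p_gt0) u_ge0).
    lra.
  by rewrite mulrDl !mulrDr mulr1 mulrA mp; ring.
(* Rows of U and I: r u is at least (m - 1) u = e + K p - u. *)
have X_row u e : 0 <= u -> u = e * p + K * p ^+ 2 -> e + K * p - u <= r * u.
  move=> u_ge0 uE; rewrite rE mulrDl; have : 0 <= eps * u by rewrite mulr_ge0.
  have : m * u = e + K * p.
    by rewrite uE mulrDr mulrCA mp mulr1 expr2 mulrCA (mulrA m) mp mul1r.
  rewrite mulrBl mul1r; lra.
have omega_gt0 : 0 < omega by rewrite omegaE addr_gt0 // mulr_gt0.
have zeta_gt0 : 0 < zeta by rewrite zetaE addr_gt0 // mulr_gt0.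
split=> //; split.
- have := X_row alpha (a + 1) (ltW alpha_gt0) alphaE.
  have : a * (p * s) <= a * s by rewrite ler_wpM2l.
  rewrite omegaE zetaE; lra.
- have := X_row beta a (ltW beta_gt0) betaE.
  have : a * (p * s) <= a * s by rewrite ler_wpM2l.
  rewrite omegaE zetaE; lra.
- have := clique s (ltW s_gt0); rewrite rE -omegaE; lra.
- have := clique alpha (ltW alpha_gt0); rewrite rE -zetaE; lra.
- have := clique 0 (lexx 0); rewrite rE mulr0 addr0; lra.
Qed.

Lemma sum_kept (V : nmodType) (a : nat) (f : 'I_5 -> V) :
  (a = 0%N -> f (Ordinal (isT : 2 < 5)%N) = 0) ->
  \sum_j f (@kept a j) = \sum_j f j.
Proof.
case: a => [|a] f2 //=; pose i2 := Ordinal (isT : (2 < 5)%N).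
by rewrite [RHS](bigD1_ord i2) //= f2 // add0r.
Qed.

Lemma exists_superset_card (T : finType) (A : {set T}) (m : nat) :
  (#|A| <= m <= #|T|)%N -> exists2 B : {set T}, A \subset B & #|B| = m.
Proof.
move=> /andP[]; elim: m => [|m IH] Am mT.
  by exists A => //; apply/eqP; rewrite -leqn0.
have [Em|ltAm] : #|A| = m.+1 \/ (#|A| <= m)%N by lia.
  by exists A.
have [B AB cB] := IH ltAm (ltnW mT).
have /set0Pn[x xB] : ~: B != set0.
  by rewrite -card_gt0; have := cardsC B; lia.
exists (x |: B); first by rewrite subsetU // AB orbT.
by rewrite cardsU1 cB; move: xB; rewrite inE => ->.
Qed.

(** * Comparison with the minimal graph *)

Section Comparison.
Variables (R : realType) (h k n : nat).
Hypothesis h_gt0 : (0 < h)%N.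
Hypothesis k_gt : (h < k)%N.
Let a := (k - h - 1)%N.
Let b := (n - k - h - 1)%N.
Let K := ((2 * h + 2) * (a + 1) * (a + 2))%N.
Let D := (2 * h * (a + 1) + 2 * a)%N.
Let S := (2 * h * (a + 1) ^ 2 + 2 * a ^ 2)%N.

Lemma Qmin_radius_le : (2 * (k + h) + 2 <= n)%N ->
  (K <= a + b)%N -> (K * D <= a + b)%N ->
  spectral_radius (Qmin h k n R) <=
    (a + b)%:R - 1 + (S + 1)%:R / (a + b)%:R ^+ 2.
Proof.
move=> n_large Km KDm; set r := (X in _ <= X).
pose A : R := a%:R; pose t : R := (2 * h)%N%:R; pose q : R := (qmin h k n)%:R.
pose m : R := (a + b)%:R; pose p := m^-1.
pose Kr := (t + 2) * (A + 1) * (A + 2).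
pose alpha := (A + 1) * p + Kr * p ^+ 2; pose beta := A * p + Kr * p ^+ 2.
pose s := t * alpha + 2 * beta.
have KE : Kr = K%:R by rewrite /K 2!natrM (natrD _ (2 * h)) !(natrD _ a).
have [] // := @trial_vector_bounds R t A q m p S%:R Kr (t * (A + 1) + 2 * A)
  r alpha beta s (1 + p * s) (1 + p * alpha).
- by rewrite ler_nat; lia.
- rewrite /m /A /t /q -!natrD; congr (_%:R); rewrite /qmin /b; lia.
- by rewrite /S natrD (natrM _ (2 * h)) (natrM _ 2 (a ^ 2)) !natrX natrD.
- by rewrite KE ler_nat.
- rewrite (_ : Kr * _ = (K * D)%:R) ?ler_nat //.
  by rewrite natrM -KE /D natrD (natrM _ (2 * h)) (natrM _ 2 a) natrD.
- by rewrite /r (natrD _ S 1) exprVn.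
move=> alpha_gt0 beta_gt0 omega_gt0 zeta_gt0 [rowU rowI rowW rowZ rowY].
set omega := 1 + p * s in omega_gt0 rowU rowI rowW rowZ rowY.
set zeta := 1 + p * alpha in zeta_gt0 rowU rowI rowW rowZ rowY.
have r_ge0 : 0 <= r.
  rewrite /r addr_ge0 ?divr_ge0 ?exprn_ge0 // subr_ge0 ler1n /b; lia.
pose v5 (i : 'I_5) := nth 0 [:: alpha; beta; omega; zeta; 1] i.
have v5_gt0 i : 0 < v5 i.
  by case: i => [[|[|[|[|[|//]]]]] lt_i]; rewrite /v5 //=.
apply: spectral_radius_le => // z.
apply: (@nonneg_subeigenvalue_le _ _ _ (\col_i v5 (kept i))) => [i j|i|i].
- by rewrite QminE // mxE ler0n.
- by rewrite mxE.
rewrite !mxE.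
have i2 : (kept i != 2 :> nat) || (0 < a)%N by apply/mem_kept; exists i.
under eq_bigr => j _.
  rewrite [Qmin _ _ _ _ _ _]mxE [(\col__ _) _ _]mxE.
over.
rewrite (@sum_kept _ (k - h - 1) (fun j => Qmin5 h k n R (kept i) j * v5 j)).
  rewrite !big_ord_recl big_ord0 /v5 !mxE addr0 /= !addrA.
  by case: (kept i) => [[|[|[|[|[|//]]]]] lt_i].
move=> a0; move: i2.
rewrite [(0 < a)%N](_ : _ = false) ?orbF; last by rewrite /a a0.
rewrite mxE; move: (kept i) => [[|[|[|[|[|//]]]]] lt_i] //= _;
  by rewrite -/a [a](a0 : a = 0%N) mul0r.
Qed.

Variables (G H : sgraph) (F : {set H * 'I_b}).
Hypothesis isoG : isomorphic G (cross_graph a F).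
Hypothesis cardH : #|H| = (2 * h + 2)%N.
Hypothesis deg_f : forall x : H, (degree x + cross_degree F x = 2 * h + 1)%N.
Hypothesis cardF : #|F| = (2 * h)%N.
Hypothesis n_large : (2 * (k + h) + 2 <= n)%N.

Lemma matched_radius_ge : (forall x : H, (cross_degree F x <= 1)%N) ->
  graph_radius R (Gmin h k n) <= graph_radius R G.
Proof.
move=> f_le1.
have [|Z F_Z cardZ] := @exists_superset_card _ [set p.2 | p in F] (2 * h).
  by rewrite -{1}cardF leq_imset_card card_ord /b; lia.
have F_Z' x y : (x, y) \in F -> y \in Z.
  by move=> xy; apply: (subsetP F_Z); apply/imsetP; exists (x, y).
have hb : (2 * h < b)%N by rewrite /b; lia.
have part := class_partition a cardH cardF f_le1 cardZ h_gt0 hb.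
apply: (averaged_quotient_le (Q := Qmin h k n R) part isoG); last first.
  apply: quotient_perron (min_partition _ _ _) _ _ => //; last first.
    exact: min_quotient_mx.
  by case: (k - h - 1)%N.
move=> i j; rewrite -natr_sum.
rewrite (sum_class_counts _ cardH deg_f cardF f_le1 cardZ F_Z').
rewrite (card_class_set _ cardH cardF f_le1 cardZ) natrM; congr (_ * _).
by rewrite QminE // mxE.
Qed.

(** Since f ^ 2 >= f for natural numbers, (a + f) ^ 2 >= a ^ 2 + (2 a + 1) f,
    with strict inequality as soon as f >= 2; the right-hand sides sum up to
    S. *)
Lemma unmatched_radius_ge (x0 : H) : (1 < cross_degree F x0)%N ->
  (S + 1 <= a + b)%N ->
  (a + b)%:R - 1 + (S + 1)%:R / (a + b)%:R ^+ 2 <= graph_radius R G.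
Proof.
move=> f_x0 Sm; apply: (cross_radius_ge isoG) => //.
- by lia.
- rewrite -(eq_bigr _ (fun x _ => natrX R (a + cross_degree F x) 2)).
  rewrite -natr_sum ler_nat.
  have le_x x : (a ^ 2 + (2 * a + 1) * cross_degree F x <=
                 (a + cross_degree F x) ^ 2)%N.
    by case: cross_degree => [|f]; nia.
  have sumE : (\sum_(x : H) (a ^ 2 + (2 * a + 1) * cross_degree F x) = S)%N.
    rewrite big_split /= sum_nat_const -big_distrr /= sum_cross_degree cardF.
    by rewrite cardH /S; nia.
  rewrite -sumE (bigD1 x0) //= [leqRHS](bigD1 x0) //= addnAC leq_add //.
    by nia.
  by apply: leq_sum => x _; apply: le_x.
- rewrite -natrX ler_nat; nia.
Qed.

End Comparison.

Theorem proposition2p14 (R : realType) (h k : nat) (h_ge1 : (1 <= h)%N)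
    (k_geh1 : (h + 1 <= k)%N) :
  exists nint : nat,
    (2 * (k + h) + 2 <= nint)%N /\
    forall n : nat, (nint <= n)%N ->
      [/\ equitable (@min_classes h k n),
          forall i, #|@min_classes h k n i| = @min_sizes h k n i,
          is_quotient_mx (@min_classes h k n) (Qmin h k n R),
          is_min_radius (family_L2H n k (k + h)) (graph_radius R (Gmin h k n))
        & graph_radius R (Gmin h k n) = spectral_radius (Qmin h k n R)].
Proof.
have k_gt : (h < k)%N by rewrite -addn1.
pose a := (k - h - 1)%N.
pose K := ((2 * h + 2) * (a + 1) * (a + 2))%N.
pose D := (2 * h * (a + 1) + 2 * a)%N.
pose S := (2 * h * (a + 1) ^ 2 + 2 * a ^ 2)%N.
(* Only m >= K, K * D, S + 1 is used, and m = n - 2h - 2. *)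
exists (2 * (k + h) + 2 + K + K * D + S + 1)%N; split; first by lia.
move=> n le_n.
have n_large : (2 * (k + h) + 2 <= n)%N by lia.
have part := min_partition h_ge1 k_gt n_large.
have quot := min_quotient_mx h_ge1 k_gt n_large R.
have radiusE : graph_radius R (Gmin h k n) = spectral_radius (Qmin h k n R).
  by apply: quotient_radiusE part _ quot; case: (k - h - 1)%N.
split=> //.
- by split=> //; case: quot => q qV _; exists q.
- exact: card_min_classes.
- split; first by exists (Gmin h k n) => //; apply: Gmin_family.
move=> G; rewrite /family_L2H addKn.
move=> [H [F [cardH _ cardE [cardF deg_ge] isoG]]].
have deg_f := family_cross_degree k_geh1 cardH cardE cardF deg_ge.
have [/forallP f_le1|] := boolP [forall x, cross_degree F x <= 1]%N.
  exact: (matched_radius_ge R h_ge1 k_gt isoG cardH deg_f cardF n_large f_le1).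
rewrite negb_forall => /existsP[x0]; rewrite -ltnNge => f_x0.
rewrite radiusE; apply: (le_trans (Qmin_radius_le _ _ _ _ _ _)) => //.
- by rewrite -/a -/K; lia.
- by rewrite -/a -/K -/D; lia.
apply: (unmatched_radius_ge R h_ge1 k_gt isoG cardH cardF n_large f_x0).
by rewrite -/a -/S; lia.
Qed.
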